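(* Let $K$ be a field of characteristic two, let $K^{\mathrm{alg}}$ be a fixed algebraic closure of $K$, and let $L\subseteq K^{\mathrm{alg}}$ be a Galois extension of $K$ such that $\mathrm{Gal}(L|K)\cong D_4$. Then there exist $F,G,H\in K$ and $q,r\in K^{\mathrm{alg}}$ such that $q^2+q=F$, $r^2+r=Gq+H$, and $L$ is the Galois closure over $K$ of $K[q,r]$.
   Context: $D_4$ is the dihedral group of order 8. *)

(* Defs.v *)
From mathcomp Require Import all_boot all_order all_algebra all_fingroup.
From mathcomp Require Import all_solvable all_field.

Set Implicit Arguments.
Unset Strict Implicit.
Unset Printing Implicit Defensive.

Import GRing.Theory.
Local Open Scope ring_scope.

(* A field between K and Omega is represented by a field L together with a    *)
(* ring morphism j : L -> Omega (injective, since L is a field) that extends  *)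
(* iota : K -> Omega; the actual subfield of Omega is the image of j.         *)

Definition image_of (L Omega : Type) (j : L -> Omega) (x : Omega) : Prop :=
  exists y : L, x = j y.

Definition is_algebraic_closure (K : fieldType) (Omega : closedFieldType)
    (iota : {rmorphism K -> Omega}) : Prop :=
  forall x : Omega, algebraicOver iota x.

(* The finite Galois extensions of K inside Omega.                            *)
Definition galois_inside (K : fieldType) (Omega : closedFieldType)
    (iota : {rmorphism K -> Omega}) (L : splittingFieldType K)
    (j : {rmorphism L -> Omega}) : Prop :=
  (forall a : K, j a%:A = iota a) /\ galois 1 {:L}.

(* K[x, y], the set of values at (x, y) of the polynomials over K.            *)
Definition adjoin2 (K : fieldType) (Omega : closedFieldType)
    (iota : {rmorphism K -> Omega}) (x y z : Omega) : Prop :=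
  exists p : {poly {poly K}}, z = (map_poly (map_poly iota) p).[x, y].

(* (L, j) is the smallest Galois extension of K inside Omega containing E.    *)
(* If E lies in some finite extension of K, restricting the comparison to     *)
(* finite Galois extensions M is harmless: a Galois extension of K containing *)
(* E contains a finite one that contains E.                                   *)
Definition is_galois_closure (K : fieldType) (Omega : closedFieldType)
    (iota : {rmorphism K -> Omega}) (E : Omega -> Prop)
    (L : splittingFieldType K) (j : {rmorphism L -> Omega}) : Prop :=
  [/\ galois_inside iota j,
      forall x : Omega, E x -> image_of j x
    & forall (M : splittingFieldType K) (m : {rmorphism M -> Omega}),
        galois_inside iota m ->
        (forall x : Omega, E x -> image_of m x) ->
        forall x : Omega, image_of j x -> image_of m x].

(* Main.v *)
(* Let A be a non-normal subgroup of order 2 of the Galois group and B its    *)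
(* normalizer, so that A < B < Gal are steps of index 2. Artin-Schreier    *)
(* theory gives q fixed by B, r fixed by A such that other elements of Gal,   *)
(* resp. B, add 1 to q, resp. r. Then F = q^2 + q lies in K, while            *)
(* d = r^2 + r lies in K(q); writing d' for its conjugate, G = d + d' and     *)
(* H = d + G q lie in K and d = G q + H. The fixed group of q, r and a        *)
(* conjugate s(r) is the intersection of A with a conjugate distinct from A,  *)
(* which is trivial, so any normal extension of K containing q and r contains *)
(* L.                                                                         *)
Require Import Defs.
From mathcomp Require Import all_boot all_order all_algebra all_fingroup.
From mathcomp Require Import all_solvable all_field.
Set Implicit Arguments.
Unset Strict Implicit.
Unset Printing Implicit Defensive.
Import GRing.Theory.
Local Open Scope ring_scope.

(** The groups of the outline come from [dihedral8_subgroups]: [A] is generated by a reflection [y],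
    and a rotation [x] of order 4 moves [A] to another conjugate. [index2_artin_schreier], applied
    to each step of index 2, gives [q] and [r]. For minimality, [image_of_gal] puts the conjugate of
    [r] into M, and [image_of_Fadjoin] carries this over to all of L, which [q], [r] and that
    conjugate generate. *)

Lemma dihedral8_subgroups (gT : finGroupType) (G : {group gT}) :
    (G \isog 'D_8)%g ->
  exists A B : {group gT},
    [/\ A \subset B, B \subset G, #|B : A|%g = 2%N, #|G : B|%g = 2%N
      & exists2 g, g \in G & (A :&: A :^ g = 1)%g].
Proof.
move=> isoG; have [] := @generators_2dihedral gT G 3 isT isoG.
move=> [x y] [oG Gx ox /setDP[Gy X'y]] [oy xy].
have sYG : <[y]>%g \subset G by rewrite cycle_subG.
(* If [x] normalized [<[y]>], it would commute with [y]; but [y] inverts [x], so the order of [x]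
   would divide 2 instead of being 4. *)
have nYx : x \notin 'N(<[y]>)%g.
  apply/negP => Nx.
  have yx : (y ^ x = y)%g.
    have : (y ^ x)%g \in <[y]>%g by rewrite memJ_norm ?cycle_id.
    rewrite cycle2g // !inE conjg_eq1 => /orP[|/eqP //].
    by rewrite -order_eq1 oy.
  have cxy : (x ^ y = x)%g by apply/conjg_fixP/commgP/commute_sym/commgP/conjg_fixP.
  have : (#[x]%g %| 2)%N by rewrite order_dvdn expgS expg1 -{1}cxy xy mulVg.
  by rewrite ox.
have pG : (2.-group G)%g by rewrite /pgroup oG.
have sYN := normG <[y]>%g.
have oY : #|<[y]>%g| = 2%N by [].
(* A proper subgroup of a 2-group is strictly smaller than its normalizer, which here must therefore
   have order 4. *)
have prYN : <[y]>%g \proper 'N_G(<[y]>)%g.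
  apply: nilpotent_proper_norm (pgroup_nil pG) _; rewrite properE sYG.
  by apply/negP => /subset_leq_card; rewrite oG oY.
have prNG : 'N_G(<[y]>)%g \proper G.
  by rewrite properE subsetIl; apply: contra nYx => /subsetP/(_ x Gx)/setIP[].
have oN : #|'N_G(<[y]>)%g| = 4%N.
  have dN : (#|'N_G(<[y]>)%g| %| 8)%N by rewrite -[8%N]oG cardSg ?subsetIl.
  have := proper_card prYN; have := proper_card prNG; rewrite oG oY.
  by move: (#|_|) dN; do 9?case=> //.
exists <[y]>%G, 'N_G(<[y]>)%G; split.
- exact: proper_sub prYN.
- exact: subsetIl.
- by rewrite -divgS ?(proper_sub prYN) //= oN oY.
- by rewrite -divgS ?subsetIl //= oG oN.
exists x => //; apply/eqP; apply: contraR nYx => ntI.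
have prY : prime #|<[y]>%g| by rewrite oY.
have := prime_meetG prY ntI.
move=> sYYx; have eqY : (<[y]> = <[y]> :^ x)%g.
  by apply/eqP; rewrite eqEcard sYYx cardJg leqnn.
by apply/normP; rewrite -eqY.
Qed.

(* q is the A-trace of an element of B-trace 1; the latter is obtained by     *)
(* scaling an element of nonzero B-trace, which exists by the independence of *)
(* automorphisms.                                                             *)
Lemma index2_artin_schreier (K : fieldType) (L : splittingFieldType K)
    (A B : {group gal_of {:L}}) :
    2%N \in [pchar K] -> A \subset B -> #|B : A|%g = 2%N ->
  exists2 q, q \in fixedField A & forall b, b \in B :\: A -> b q = q + 1.
Proof.
move=> char2 sAB iAB.
have charL : 2%N \in [pchar L] by rewrite pchar_lalg.
have trM (C : {group gal_of {:L}}) (a : L) x :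
    x \in C -> x (\sum_(y in C) y a) = \sum_(y in C) y a.
  move=> Cx; rewrite rmorph_sum [RHS](reindex_acts 'R _ Cx) ?astabsR //=.
  by apply: eq_bigr => y _; rewrite galM ?memvf.
have [a _] := @gal_independent_contra _ _ {:L} [in B] (fun=> 1) 1%g (group1 B)
  (oner_neq0 _).
under eq_bigr do rewrite mul1r.
set T := \sum_(y in B) y a => nzT; pose S := \sum_(y in A) y a.
exists (S / T) => [|b /setDP[Bb A'b]].
  apply/fixedFieldP; rewrite ?memvf // => x Ax.
  by rewrite fmorph_div /= !trM // (subsetP sAB).
rewrite fmorph_div /= [b T]trM //; apply: (canLR (mulfK nzT)).
rewrite mulrDl mul1r divfK //.
(* The sum over [B] splits along the two cosets [A] and [A :* b]; hence [b S = S + T] in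
   characteristic two. *)
have -> : T = S + b S.
  rewrite /T (bigID [in A]) /=; congr (_ + _).
    by apply: eq_bigl => y; rewrite andbC; case Ay: (y \in A); rewrite // (subsetP sAB).
  rewrite rmorph_sum (eq_bigl [in A :* b]%g) => [|y]; last first.
    by rewrite (rcoset_index2 sAB iAB) ?inE ?A'b // andbC.
  rewrite (reindex_inj (mulIg b)) /=.
  apply: eq_big => y; first by rewrite mem_rcoset mulgK.
  by move=> _; rewrite galM ?memvf.
by rewrite addrA addrr_pchar2 ?add0r.
Qed.

(* M is normal over K, so it contains all the K-conjugates of its elements.   *)
Lemma image_of_gal (K : fieldType) (Omega : closedFieldType)
    (iota : {rmorphism K -> Omega}) (L M : splittingFieldType K)
    (j : {rmorphism L -> Omega}) (m : {rmorphism M -> Omega}) g x :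
    galois_inside iota j -> galois_inside iota m -> g \in 'Gal({:L} / 1)%g ->
  image_of m (j x) -> image_of m (j (g x)).
Proof.
move=> [jE _] [mE galoisM] Gg [y jx].
have /and3P[_ _ nM] := galoisM.
have [r _ Dr] := normalField_factors (subvf _) nM y (memvf y).
have [p Dp] := polyOver1P (minPolyOver 1 y).
have jp z : (map_poly iota p).[j z] = j (map_poly (in_alg L) p).[z].
  rewrite -horner_map -map_poly_comp /=; congr _.[_].
  by apply: eq_map_poly => a /=; rewrite jE.
have mp : map_poly iota p = map_poly m (minPoly 1 y).
  by rewrite Dp -map_poly_comp; apply: eq_map_poly => a /=; rewrite mE.
have px0 : (map_poly (in_alg L) p).[x] = 0.
  by apply: (fmorph_inj j); rewrite -jp jx mp horner_map minPolyxx !rmorph0.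
(* The minimal polynomial of [y] over K vanishes at [x], hence at [g x]; by normality it splits in M
   with roots [z y]. *)
have : root (map_poly m (minPoly 1 y)) (j (g x)).
  rewrite -mp rootE jp -[X in X.[_]](fixedPoly_gal (subvf _) Gg); last first.
    by apply/polyOver1P; exists p.
  by rewrite horner_map px0 !rmorph0.
rewrite Dr rmorph_prod; under eq_bigr do rewrite /= map_polyXsubC.
rewrite -(big_map (fun z : gal_of {:M} => m (z y)) xpredT (fun b => 'X - b%:P)).
by rewrite root_prod_XsubC => /mapP[z _ ->]; exists (z y).
Qed.

Lemma image_of_Fadjoin (K : fieldType) (Omega : closedFieldType)
    (L M : splittingFieldType K)
    (j : {rmorphism L -> Omega}) (m : {rmorphism M -> Omega})
    (U : {subfield L}) x :
    (forall y, y \in U -> image_of m (j y)) -> image_of m (j x) ->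
  forall y, y \in <<U; x>>%VS -> image_of m (j y).
Proof.
move=> Um [x' jx] _ /Fadjoin_polyP[p Up ->].
elim/poly_ind: p Up => [|p c IHp] Up.
  by exists 0; rewrite horner0 !rmorph0.
have Uc : c \in U by have := polyOverP Up 0%N; rewrite coefD coefMX coefC add0r.
have {}Up : p \is a polyOver U.
  apply/polyOverP=> i.
  by have := polyOverP Up i.+1; rewrite coefD coefMX coefC addr0.
have [u pu] := IHp Up; have [v cv] := Um c Uc.
by exists (u * x' + v); rewrite hornerMXaddC !rmorphD !rmorphM /= pu cv jx.
Qed.

Lemma adjoin2_image (K : fieldType) (Omega : closedFieldType)
    (iota : {rmorphism K -> Omega}) (L : splittingFieldType K)
    (j : {rmorphism L -> Omega}) x y z :
    galois_inside iota j -> adjoin2 iota (j x) (j y) z -> image_of j z.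
Proof.
move=> [jE _] [p ->]; exists (map_poly (map_poly (in_alg L)) p).[x, y].
rewrite -!horner_map /= map_polyC /= -map_poly_comp; congr _.[_, _].
apply: eq_map_poly => q /=; rewrite -map_poly_comp.
by apply: eq_map_poly => a /=; rewrite jE.
Qed.

Lemma mem_adjoin2l (K : fieldType) (Omega : closedFieldType)
    (iota : {rmorphism K -> Omega}) x y : adjoin2 iota x y x.
Proof. by exists 'X; rewrite map_polyX hornerX hornerC. Qed.

Lemma mem_adjoin2r (K : fieldType) (Omega : closedFieldType)
    (iota : {rmorphism K -> Omega}) x y : adjoin2 iota x y y.
Proof. by exists 'X%:P; rewrite map_polyC hornerC /= map_polyX hornerX. Qed.

Theorem proposition4p1 (K : fieldType) (char2 : 2%N \in [pchar K])
    (Kalg : closedFieldType) (iota : {rmorphism K -> Kalg})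
    (Kalg_closure : is_algebraic_closure iota)
    (L : splittingFieldType K) (j : {rmorphism L -> Kalg})
    (L_galois : galois_inside iota j)
    (L_D4 : ('Gal({:L} / 1) \isog 'D_8)%g) :
  exists (F G H : K) (q r : Kalg),
    [/\ q ^+ 2 + q = iota F,
        r ^+ 2 + r = iota G * q + iota H
      & is_galois_closure iota (adjoin2 iota q r) j].
Proof.
have [jE galL] := L_galois.
have charL : 2%N \in [pchar L] by rewrite pchar_lalg.
have addxx (x : L) : x + x = 0 by apply: addrr_pchar2.
pose Gal := 'Gal({:L} / 1)%G.
have baseP (x : L) : (forall g, g \in Gal -> g x = x) -> {a : K | x = a%:A}.
  move=> Gx; apply: sig_eqW; apply/vlineP; rewrite -/(1%VS).
  by rewrite -(galois_fixedField galL); apply/fixedFieldP; rewrite ?memvf.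
have [A [B [sAB sBG iAB iBG [s Gs tiA]]]] := dihedral8_subgroups L_D4.
have [q /mem_fixedFieldP[_ Bq] q1] := index2_artin_schreier char2 sBG iBG.
have [r /mem_fixedFieldP[_ Ar] r1] := index2_artin_schreier char2 sAB iAB.
(* In characteristic two, x^2 + x does not change when 1 is added to x. *)
have AS1 (x : L) : (x + 1) ^+ 2 + (x + 1) = x ^+ 2 + x.
  by rewrite sqrrD1 mulr2n addxx addr0 addrACA addxx addr0.
have fixAS (C D : {group gal_of {:L}}) x :
    (forall c, c \in C -> c x = x) -> (forall d, d \in D :\: C -> d x = x + 1) ->
  forall d, d \in D -> d (x ^+ 2 + x) = x ^+ 2 + x.
  move=> Cx Dx d Dd; rewrite rmorphD rmorphXn /=.
  have [/Cx-> //|C'd] := boolP (d \in C).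
  by rewrite Dx ?AS1 // inE C'd.
have [F DF] := baseP _ (fixAS _ _ _ Bq q1).
move Dd: (r ^+ 2 + r) (fixAS _ _ _ Ar r1) => d Bd.
have nsBG : (B <| Gal)%g by apply: index2_normal.
have [g /setDP[Gg B'g]] : exists g, g \in Gal :\: B.
  by apply/set0Pn; rewrite setD_eq0 -indexg_eq1 iBG.
have gq : g q = q + 1 by apply: q1; rewrite inE B'g.
(* [Gal] is the union of [B] and [B :* g], so fixity under [B] and [g] suffices. *)
have GB x : (forall b, b \in B -> b x = x) -> g x = x ->
    forall h, h \in Gal -> h x = x.
  move=> Bx gx h Gh; have [/Bx //|B'h] := boolP (h \in B).
  have : h \in (B :* g)%g by rewrite (rcoset_index2 sBG iBG) ?inE ?B'h ?B'g.
  by case/rcosetP=> b Bb ->; rewrite galM ?memvf // Bx.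
have Bgd b : b \in B -> b (g d) = g d.
  move=> Bb; rewrite -galM ?memvf // conjgCV galM ?memvf // Bd //.
  by rewrite memJ_norm ?groupV // (subsetP (normal_norm nsBG)).
(* [g * g] lies in [B], as [B] has index 2. *)
have ggd : g (g d) = d.
  rewrite -galM ?memvf // Bd //.
  have : (g^-1 \in B :* g)%g.
    by rewrite (rcoset_index2 sBG iBG) ?inE ?groupV ?B'g.
  by rewrite mem_rcoset -invMg groupV.
have [G DG] : {a : K | d + g d = a%:A}.
  apply: baseP; apply: GB => [b Bb|]; first by rewrite rmorphD /= Bd ?Bgd.
  by rewrite rmorphD /= ggd addrC.
(* Applying [g] swaps [d] and [g d] and adds [d + g d] to the product; the two changes cancel. *)
have [H DH] : {a : K | d + (d + g d) * q = a%:A}.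
  apply: baseP; apply: GB => [b Bb|]; first by rewrite !(rmorphD, rmorphM) /= Bd ?Bgd ?Bq.
  rewrite !(rmorphD, rmorphM) /= ggd gq mulrDr mulr1 (addrC (g d) d).
  by rewrite addrCA [g d + _]addrC -addrA addxx addr0 addrC.
exists F, G, H, (j q), (j r); split.
- by rewrite -jE -DF !(rmorphD, rmorphXn).
- rewrite -!jE -DG -DH -rmorphXn -rmorphM -!rmorphD /= Dd; congr (j _).
  by rewrite addrCA addxx addr0.
split=> // [x|M m Mgal Mqr]; first exact: adjoin2_image.
have [mE _] := Mgal.
have Mq : image_of m (j q) by apply/Mqr/mem_adjoin2l.
have Mr : image_of m (j r) by apply/Mqr/mem_adjoin2r.
have Msr := image_of_gal L_galois Mgal Gs Mr.
pose E := <<<<<<1; q>>; r>>; s r>>%AS.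
have fixA x : x \in Gal -> x q = q -> x r = r -> x \in A.
  have nfix y z : x y = y -> x y = y + 1 -> z.
    by move=> -> /eqP; rewrite -subr_eq0 opprD addNKr oppr_eq0 oner_eq0.
  move=> Gx xq xr; have [Bx|B'x] := boolP (x \in B); last first.
    by apply: (nfix q) => //; apply: q1; rewrite inE B'x.
  have [//|A'x] := boolP (x \in A).
  by apply: (nfix r) => //; apply: r1; rewrite inE A'x.
have EL : E = {:L}%AS :> {vspace L}.
  have galE : galois E {:L} by apply: galoisS galL; rewrite sub1v subvf.
  have Eq : q \in E by do 2!apply: (subvP (subv_adjoin _ _)); apply: memv_adjoin.
  have Er : r \in E by apply: (subvP (subv_adjoin _ _)); apply: memv_adjoin.
  have Esr : s r \in E by apply: memv_adjoin.
  rewrite -(galois_fixedField galE); apply/eqP.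
  rewrite eqEsubv subvf; apply/subvP=> z _; apply/fixedFieldP; rewrite ?memvf //.
  move=> x Ex; suff -> : x = 1%g by rewrite gal_id.
  have fixE := fixed_gal (subvf _) Ex.
  have Gx : x \in Gal by apply: subsetP Ex; apply/galS/sub1v.
  have Ax : x \in A by apply: fixA; rewrite ?fixE.
  (* This conjugate of [x] fixes [q] because it lies in [B], and fixes [r] because [x] fixes [s r].
     It is thus in [A], which puts [x] in [A :&: A :^ s]. *)
  have Bxs : (x ^ s^-1)%g \in B.
    by rewrite memJ_norm ?groupV ?(subsetP sAB) ?(subsetP (normal_norm nsBG)).
  apply/set1gP; rewrite -tiA inE Ax mem_conjg.
  apply: fixA; [by rewrite groupJ ?groupV|exact: Bq|].
  by rewrite conjgE invgK galM ?memvf // galM ?memvf // fixE // -galM ?memvf // mulgV gal_id.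
have ME y : y \in E -> image_of m (j y).
  do 3![apply: image_of_Fadjoin => //].
  move=> z /vlineP[a ->]; exists a%:A; by rewrite jE mE.
by move=> _ [x ->]; apply: ME; rewrite EL memvf.
Qed.
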